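(* Let $G$ be a graph on $n\geq 4$ vertices with minimum degree $\delta(G)\geq 1$. If $\rho(G)>n-3$, then $G$ contains a Hamilton path unless $G$ is isomorphic to one of the graphs $K_1\vee (K_{n-3}+2K_1)$, $K_2\vee 4K_1$, $K_1\vee (K_{1,3}+K_1)$.
   Context: All graphs are finite, simple and undirected. The spectral radius $\rho(G)$ of a graph $G$ is the largest eigenvalue of its adjacency matrix. $K_n$ is the complete graph on $n$ vertices and $K_{s,t}$ is the complete bipartite graph with parts of sizes $s$ and $t$. $G_1+G_2$ denotes the disjoint union of two graphs, $kG$ denotes the union of $k$ disjoint copies of $G$, and the join $G_1\vee G_2$ is obtained from $G_1+G_2$ by joining each vertex of $G_1$ to each vertex of $G_2$. A Hamilton path is a path containing all vertices of the graph. *)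

(* Defs.v *)
From HB Require Import structures.
From mathcomp Require Import all_boot all_order all_algebra.

Set Implicit Arguments.
Unset Strict Implicit.
Unset Printing Implicit Defensive.

Import Order.TTheory GRing.Theory Num.Theory.

Record sgraph := SGraph {
  vertex :> finType;
  adj : rel vertex;
  adj_sym : symmetric adj;
  adj_irrefl : irreflexive adj }.

Definition isomorphic (G H : sgraph) : Prop :=
  exists2 f : G -> H, bijective f & forall x y, adj (f x) (f y) = adj x y.

Definition complete_adj (n : nat) : rel 'I_n := fun i j => i != j.

Lemma complete_adj_sym n : symmetric (@complete_adj n).
Proof. by move=> i j; rewrite /complete_adj eq_sym. Qed.

Lemma complete_adj_irrefl n : irreflexive (@complete_adj n).
Proof. by move=> i; rewrite /complete_adj eqxx. Qed.

Definition complete (n : nat) : sgraph :=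
  SGraph (@complete_adj_sym n) (@complete_adj_irrefl n).

Definition complete_bipartite_adj (s t : nat) : rel ('I_s + 'I_t) :=
  fun x y => match x, y with
             | inl _, inr _ | inr _, inl _ => true
             | _, _ => false
             end.

Lemma complete_bipartite_adj_sym s t : symmetric (@complete_bipartite_adj s t).
Proof. by case=> i [] j. Qed.

Lemma complete_bipartite_adj_irrefl s t :
  irreflexive (@complete_bipartite_adj s t).
Proof. by case. Qed.

Definition complete_bipartite (s t : nat) : sgraph :=
  SGraph (@complete_bipartite_adj_sym s t) (@complete_bipartite_adj_irrefl s t).

Definition disjoint_union_adj (G H : sgraph) : rel (G + H) :=
  fun x y => match x, y with
             | inl u, inl v => adj u v
             | inr u, inr v => adj u v
             | _, _ => false
             end.

Lemma disjoint_union_adj_sym G H : symmetric (@disjoint_union_adj G H).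
Proof. by case=> u [] v //=; apply: adj_sym. Qed.

Lemma disjoint_union_adj_irrefl G H : irreflexive (@disjoint_union_adj G H).
Proof. by case=> u /=; apply: adj_irrefl. Qed.

Definition disjoint_union (G H : sgraph) : sgraph :=
  SGraph (@disjoint_union_adj_sym G H) (@disjoint_union_adj_irrefl G H).

Definition copies_adj (k : nat) (G : sgraph) : rel ('I_k * G) :=
  fun x y => (x.1 == y.1) && adj x.2 y.2.

Lemma copies_adj_sym k G : symmetric (@copies_adj k G).
Proof. by move=> x y; rewrite /copies_adj eq_sym adj_sym. Qed.

Lemma copies_adj_irrefl k G : irreflexive (@copies_adj k G).
Proof. by move=> x; rewrite /copies_adj adj_irrefl andbF. Qed.

Definition copies (k : nat) (G : sgraph) : sgraph :=
  SGraph (@copies_adj_sym k G) (@copies_adj_irrefl k G).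

Definition join_adj (G H : sgraph) : rel (G + H) :=
  fun x y => match x, y with
             | inl u, inl v => adj u v
             | inr u, inr v => adj u v
             | _, _ => true
             end.

Lemma join_adj_sym G H : symmetric (@join_adj G H).
Proof. by case=> u [] v //=; apply: adj_sym. Qed.

Lemma join_adj_irrefl G H : irreflexive (@join_adj G H).
Proof. by case=> u /=; apply: adj_irrefl. Qed.

Definition join (G H : sgraph) : sgraph :=
  SGraph (@join_adj_sym G H) (@join_adj_irrefl G H).

Definition degree (G : sgraph) (v : G) : nat := #|[set u | adj v u]|.

(* Degrees are smaller than #|G|, so the initial value #|G| is never attained
   when G is nonempty. *)
Definition min_degree (G : sgraph) : nat :=
  \big[minn/#|G|]_(v : G) degree v.

Definition has_hamilton_path (G : sgraph) : Prop :=
  exists (x : G) (p : seq G),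
    [/\ path (@adj G) x p, uniq (x :: p) & forall v : G, v \in x :: p].

Local Open Scope ring_scope.

(* The vertices are numbered by the canonical enumeration of the finType. *)
Definition adjacency_matrix (R : nzRingType) (G : sgraph) : 'M[R]_#|G| :=
  \matrix_(i, j) (adj (enum_val i) (enum_val j))%:R.

(* The adjacency matrix of a nonempty graph is symmetric, so over a real closed
   field it has exactly one largest eigenvalue. *)
Definition is_spectral_radius (R : rcfType) (G : sgraph) (rho : R) : Prop :=
  eigenvalue (adjacency_matrix R G) rho /\
  forall mu : R, eigenvalue (adjacency_matrix R G) mu -> mu <= rho.

(* Main.v *)
(** A Bondy-Chvatal closure argument shows that a graph on n vertices without
Hamilton path has, for some j with 2j + 2 <= n, more than j vertices of degree
at most j and at least n - j vertices of degree at most n - j - 2; here j >= 1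
since there is no isolated vertex.  If j >= 2 and n >= 7, give these two classes
and the remaining vertices the weights j, n - j - 2 and n - 3: the weights of
the neighbours of a vertex add up to at most n - 3 times its own weight, so
every eigenvalue is at most n - 3.  In the remaining cases j = 1 and
(n, j) = (6, 2), the spectral hypothesis is turned into
2 e(G) >= n^2 - 5n + 10 by Hong's bound rho^2 <= 2 e(G) - n + 1 and the parity
of 2 e(G).  For j = 1 the degree conditions give the reverse inequality, and
equality determines the graph; the case n = 6 is a count of the edges between
the four vertices of degree at most 2 and the two others, which must be
adjacent because the weights 2 and 3 would otherwise give rho <= 3. *)
Require Import Defs.
From HB Require Import structures.
From mathcomp Require Import all_boot all_order all_algebra zify lra.

Set Implicit Arguments.
Unset Strict Implicit.
Unset Printing Implicit Defensive.

Import Order.TTheory GRing.Theory Num.Theory.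

(** * Hamilton paths: reconnection and the Bondy-Chvatal closure *)

Section Paths.
Variables (T : finType).
Implicit Types (e : rel T) (s : seq T).

(** A single sequence without a marked first vertex is easy to cut, reverse and concatenate. *)
Definition traceable e : Prop :=
  exists s, [/\ sorted e s, uniq s & forall v, v \in s].

Lemma not_path_split (r : rel T) x p : ~~ path r x p ->
  exists A a b B, x :: p = A ++ a :: b :: B /\ ~~ r a b.
Proof.
elim: p x => //= y p IH x; case: (boolP (r x y)) => [_ /= /IH|nr _].
  by move=> [A [a [b [B [-> h]]]]]; exists (x :: A), a, b, B.
by exists [::], x, y, p.
Qed.

Lemma sorted_cat x0 e s t : sorted e s -> sorted e t ->
  e (last x0 s) (head x0 t) -> sorted e (s ++ t).
Proof.
by case: s t => [|x s] [|y t] //= es et est; rewrite ?cats0 // cat_path es /= est.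
Qed.

Lemma sorted_rev e s : symmetric e -> sorted e s -> sorted e (rev s).
Proof.
by move=> esym; rewrite rev_sorted; apply: sub_sorted => x y; rewrite esym.
Qed.

Lemma traceable_perm e s t : perm_eq s t -> uniq s -> (forall v, v \in s) ->
  sorted e t -> traceable e.
Proof.
move=> st us alls et; exists t; split=> // [|v]; first by rewrite -(perm_uniq st).
by rewrite -(perm_mem st).
Qed.

Lemma card_count (f : pred T) s : uniq s -> (forall v, v \in s) ->
  #|[set x | f x]| = count f s.
Proof.
move=> us alls; rewrite cardE /enum_mem size_filter -enumT.
rewrite (@permP _ (enum T) s _ _) ?uniq_perm ?enum_uniq // => [|x].
  by apply: eq_count => x; rewrite /= inE.
by rewrite mem_enum alls.
Qed.

(** Charge each entry satisfying [f] to the step leaving it and each entry satisfying [g] to the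
    step entering it. No step is charged twice, the two end conditions leave no entry uncharged, and
    there are [size p] steps. *)
Lemma count_shift (f g : pred T) x p :
  path (fun a b => ~~ (f a && g b)) x p -> ~~ f (last x p) -> ~~ g x ->
  count f (x :: p) + count g (x :: p) <= size p.
Proof.
rewrite /= => pth nf /negPf ->; rewrite add0n.
elim: p x pth nf => /= [|y p IH] x; first by move=> _ /negPf ->.
by case/andP=> fg /IH{}IH /IH; case: (f x) (g y) fg => [] [] //= _; lia.
Qed.

(* A neighbour of [u] directly followed by a neighbour of [v] in either of the
   two paths lets us reconnect them; otherwise the two degrees are too small. *)
Lemma traceable_crossing e s1 u v s2 : symmetric e -> irreflexive e ->
    let s := rcons s1 u ++ v :: s2 in
    uniq s -> (forall x, x \in s) -> sorted e (rcons s1 u) -> sorted e (v :: s2) ->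
    #|T| <= #|[set x | e u x]| + #|[set x | e v x]| + 1 ->
  traceable e.
Proof.
move=> esym eirr s us alls e1 e2 le_n.
have erev := @sorted_rev e _ esym.
pose r a b := ~~ (e u a && e v b).
have [x0 [p Ep]] : exists x0 p, rcons s1 u = x0 :: p.
  by case: (s1) => [|y q]; [exists u, [::] | exists y, (rcons q u)].
have lastp : last x0 p = u by rewrite -[RHS](last_rcons x0 s1 u) Ep.
(* If [v] is adjacent to the far end [x0] of the first path, reversing that path suffices; the next
   case does the same with [u] and the second path. *)
case: (boolP (e v x0)) => [evx0|nvx0].
  apply: (@traceable_perm _ s (rev (rcons s1 u) ++ v :: s2)) => //.
    by rewrite perm_cat2r perm_sym perm_rev.
  apply: (sorted_cat (x0 := u)) => //; first exact: erev.
  by rewrite Ep rev_cons last_rcons /= esym.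
case: (boolP (e u (last v s2))) => [euz|nuz].
  apply: (@traceable_perm _ s (rcons s1 u ++ rev (v :: s2))) => //.
    by rewrite perm_cat2l perm_sym perm_rev.
  apply: (sorted_cat (x0 := u)) => //; first exact: erev.
  by rewrite last_rcons lastI rev_rcons.
(* A step failing [r] is a crossing [x], [y]: follow the first path to [x], jump to its end [u], go
   back to [y] and jump to [v]. *)
case: (boolP (path r x0 p)) => [pthP|/not_path_split]; last first.
  move=> [A [x [y [B []]]]]; rewrite -Ep => EA; rewrite negbK => /andP[eux evy].
  have lastB : last y B = u.
    by have := last_rcons x0 s1 u; rewrite EA last_cat.
  apply: (@traceable_perm _ s (rcons A x ++ rev (y :: B) ++ v :: s2)) => //.
    by rewrite /s EA -[A ++ _]cat_rcons -catA perm_cat2l perm_cat2r perm_sym perm_rev.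
  move: e1; rewrite EA -cat_rcons => /cat_sorted2[eA eB].
  apply: (sorted_cat (x0 := u)) => //.
    apply: (sorted_cat (x0 := u)) => //; first exact: erev.
    by rewrite rev_cons last_rcons /= esym.
  by rewrite last_rcons lastI rev_rcons lastB /= esym.
(* For a crossing in the second path: from [u] jump to [x], go back to [v], then jump to [y]. *)
case: (boolP (path r v s2)) => [pthQ|/not_path_split]; last first.
  move=> [A [x [y [B [EA]]]]]; rewrite negbK => /andP[eux evy].
  apply: (@traceable_perm _ s (rcons s1 u ++ rev (rcons A x) ++ y :: B)) => //.
    by rewrite /s EA -[A ++ _]cat_rcons perm_cat2l perm_cat2r perm_sym perm_rev.
  have [h Eh] : exists h, rcons A x = v :: h.
    case: A EA => [|a A] [-> _]; first by exists [::].
    by exists (rcons A x).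
  move: e2; rewrite EA -cat_rcons => /cat_sorted2[eA eB].
  apply: (sorted_cat (x0 := u)) => //; last by rewrite last_rcons rev_rcons.
  apply: (sorted_cat (x0 := u)) => //; first exact: erev.
  by rewrite Eh rev_cons last_rcons.
(* Without a crossing the two degrees add up to at most [size p + size s2], which is n - 2, against
   the assumed n - 1. *)
have cP : count (e u) (x0 :: p) + count (e v) (x0 :: p) <= size p.
  by apply: count_shift => //; rewrite lastp eirr.
have cQ : count (e u) (v :: s2) + count (e v) (v :: s2) <= size s2.
  by apply: count_shift => //; rewrite eirr.
have := cardsT T; rewrite (@card_count xpredT s) // count_predT.
move: le_n; rewrite !(@card_count _ s) // /s Ep size_cat !count_cat /=.
move: cP cQ; rewrite /=; clear; lia.
Qed.

Definition add_edge e u v : rel T :=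
  fun x y => [|| e x y, (x == u) && (y == v) | (x == v) && (y == u)].

(* For the sorted degrees d_1 <= ... <= d_n: d_(j+1) <= j and d_(n-j) <= n-j-2. *)
Definition low_degrees e j : Prop :=
  [/\ j.*2.+2 <= #|T|,
      j < #|[set x | #|[set y | e x y]| <= j]| &
      #|T| - j <= #|[set x | #|[set y | e x y]| <= #|T| - j - 2]|].

(** Carries low degrees found after adding edges back to the original graph, since deleting edges
    only lowers degrees. *)
Lemma low_degrees_sub e e' j : subrel e e' -> low_degrees e' j -> low_degrees e j.
Proof.
move=> ee' [h1 h2 h3].
have led x : #|[set y | e x y]| <= #|[set y | e' x y]|.
  by apply/subset_leq_card/subsetP => y; rewrite !inE; apply: ee'.
have lec i : #|[set x | #|[set y | e' x y]| <= i]| <=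
             #|[set x | #|[set y | e x y]| <= i]|.
  apply/subset_leq_card/subsetP => y; rewrite !inE; exact: leq_trans.
by split=> //; [apply: leq_trans h2 _ | apply: leq_trans h3 _].
Qed.

(** A Hamilton path through the new edge falls apart there into two paths of [e], which
    [traceable_crossing] reconnects. *)
Lemma traceable_add_edge e u v : symmetric e -> irreflexive e -> ~~ e u v ->
    #|T| <= #|[set x | e u x]| + #|[set x | e v x]| + 1 ->
  traceable (add_edge e u v) -> traceable e.
Proof.
move=> esym eirr nuv le_n [s [es us alls]].
case: (boolP (sorted e s)) => [ess|]; first by exists s.
case: s es us alls => // x p es us alls /not_path_split[A [a [b [B [Es nab]]]]].
rewrite Es in es us alls.
have Eab : (a = u /\ b = v) \/ (a = v /\ b = u).
  have : add_edge e u v a b.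
    move: es; rewrite -cat_rcons; case: A {Es us alls} => [|c A] /=; first by case/andP.
    by rewrite cat_path last_rcons /= => /andP[_ /andP[]].
  by rewrite /add_edge (negPf nab) /= => /orP[]/andP[/eqP-> /eqP->]; [left|right].
have leab : #|T| <= #|[set x | e a x]| + #|[set x | e b x]| + 1.
  by case: Eab => [[-> ->]|[-> ->]] //; lia.
move: es us alls; rewrite -cat_rcons => /cat_sorted2[eA eB] us alls.
(* Each of the two pieces misses one end [c] of the new edge, so it uses old edges only. *)
have sube c y z : c \in [:: a; b] -> y != c -> z != c -> add_edge e u v y z -> e y z.
  move=> hc hy hz /or3P[//| |] /andP[/eqP Ey /eqP Ez]; move: hc hy hz; rewrite Ey Ez;
  by case: Eab => [] [-> ->]; rewrite !inE => /orP[]/eqP->; rewrite ?eqxx // => ? .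
move: (us); rewrite cat_uniq => /and3P[_ /hasPn dis _].
apply: (traceable_crossing (s1 := A) (u := a) (v := b) (s2 := B)) => //.
- apply: (sub_in_sorted (P := [pred y | y != b]) _ _ eA).
    by move=> y z /= hy hz; apply: (sube b); rewrite ?inE ?eqxx ?orbT.
  apply/allP => y yA /=; apply: contraTneq yA => ->; apply: dis; exact: mem_head.
- apply: (sub_in_sorted (P := [pred y | y != a]) _ _ eB).
    by move=> y z /= hy hz; apply: (sube a); rewrite ?inE ?eqxx.
  apply/allP => y yB /=; apply: contraTneq yB => ->; apply/negP => /dis.
  by rewrite /= mem_rcons mem_head.
Qed.

(** Induction on the number of non-adjacent pairs: a pair with degree sum at least n - 1 is joined;
    if there is none, a pair of largest degree sum exhibits [j]. *)
Lemma traceable_or_low_degrees e : symmetric e -> irreflexive e ->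
  traceable e \/ exists j, low_degrees e j.
Proof.
have [m] := ubnP #|[set p : T * T | ~~ e p.1 p.2]|.
elim: m e => // m IH e lem esym eirr.
pose d x := #|[set y | e x y]|.
pose P := [pred p : T * T | (p.1 != p.2) && ~~ e p.1 p.2].
case: (pickP P) => [p0 Pp0|allP]; last first.
  (* The graph is complete, so any enumeration is a path. *)
  left; exists (enum T); split=> [||v]; rewrite ?enum_uniq ?mem_enum //.
  apply: pairwise_sorted; apply: (@sub_pairwise _ (fun x y => x != y)).
    by move=> x y xy; move: (allP (x, y)); rewrite /= xy => /negbFE.
  by rewrite -uniq_pairwise enum_uniq.
have [u [v [uv nuv duv maxd]]] : exists u v, [/\ u != v, ~~ e u v, d u <= d v &
    forall x y, x != y -> ~~ e x y -> d x + d y <= d u + d v].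
  case: (@arg_maxnP _ p0 P (fun p => d p.1 + d p.2) Pp0) => [[u v]] /= /andP[uv nuv] maxd.
  have [duv|duv] := leqP (d u) (d v); [exists u, v | exists v, u]; split=> //.
  - by move=> x y xy nxy; apply: (maxd (x, y)); rewrite /= xy.
  - by rewrite eq_sym.
  - by rewrite esym.
  - exact: ltnW.
  - by move=> x y xy nxy; rewrite [X in _ <= X]addnC; apply: (maxd (x, y)); rewrite /= xy.
case: (leqP #|T| (d u + d v + 1)) => [le_n|lt_n].
  have asym : symmetric (add_edge e u v).
    by move=> x y; rewrite /add_edge esym; do 4 case: (_ == _); rewrite ?orbT ?orbF.
  have airr : irreflexive (add_edge e u v).
    move=> x; rewrite /add_edge eirr; case: (altP (x =P u)) => [->|_]; last by rewrite andbF.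
    by rewrite (negPf uv).
  have sub : subrel e (add_edge e u v) by move=> x y exy; rewrite /add_edge exy.
  have lt : #|[set p : T * T | ~~ add_edge e u v p.1 p.2]| < m.
    rewrite -ltnS; apply: leq_trans lem; apply: proper_card.
    apply/properP; split.
      by apply/subsetP => p; rewrite !inE; apply: contra; apply: sub.
    by exists (u, v); rewrite !inE //= /add_edge !eqxx orbT.
  case: (IH _ lt asym airr) => [tr|[j lowj]].
    left; exact: (traceable_add_edge esym eirr nuv).
  right; exists j; exact: low_degrees_sub lowj.
(* By maximality the non-neighbours of [v] other than [v], more than [d u] in number, have degree at
   most [d u]. The n - [d u] non-neighbours of [u], among them [u], have degree at most [d v], hence
   at most n - [d u] - 2. *)
right; exists (d u); split; first by rewrite -mul2n; lia.
  have : #|[set x | e v x]| + #|~: [set x | e v x]| = #|T| by rewrite cardsC.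
  rewrite -/(d v) (cardsD1 v (~: _)) !inE eirr /=; set A := _ :\ v => cC.
  apply: (@leq_trans #|A|); first by move: lt_n; rewrite -cC; lia.
  apply/subset_leq_card/subsetP => x; rewrite !inE -/(d x) => /andP[xv nvx].
  by have := maxd _ _ xv; rewrite esym nvx leq_add2r => /(_ isT).
have cC : #|[set x | e u x]| + #|~: [set x | e u x]| = #|T| by rewrite cardsC.
rewrite -{1}cC -/(d u) addKn; apply/subset_leq_card/subsetP => x; rewrite !inE => nux.
rewrite -/(d x); case: (eqVneq x u) => [->|xu]; first lia.
by have := maxd _ _ xu; rewrite esym nux => /(_ isT); lia.
Qed.
End Paths.

Local Open Scope ring_scope.

(** * Upper bounds for adjacency eigenvalues *)

Section Spectrum.
Variables (R : realFieldType) (G : sgraph).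
Implicit Types (x : G -> R) (a : R).

Lemma eigenfunction a : eigenvalue (adjacency_matrix R G) a ->
  exists2 x : G -> R, (exists y, x y != 0) &
    forall y, \sum_(z | adj y z) x z = a * x y.
Proof.
case/eigenvalueP => v vA v0; exists (fun y => v 0 (enum_rank y)).
  have /existsP[i nz] : [exists i, v 0 i != 0].
    apply: contraNT v0; rewrite negb_exists => /forallP v0.
    by apply/eqP/rowP => i; rewrite mxE; apply/eqP; move: (v0 i); rewrite negbK.
  by exists (enum_val i); rewrite enum_valK.
move=> y; move/rowP: vA => /(_ (enum_rank y)); rewrite !mxE => <-.
rewrite big_mkcond (reindex (@enum_val G predT)) /=; last first.
  exact/onW_bij/enum_val_bij.
apply: eq_bigr => i _; rewrite !mxE enum_valK enum_rankK adj_sym.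
by case: (adj _ _); rewrite ?mulr1 ?mulr0.
Qed.

(** At a vertex [y] maximising |x| / w, the eigenvalue equation bounds a |x y| by a multiple of the
    weight sum over the neighbours, hence by m |x y|. *)
Lemma eigenvalue_le_weight (w : G -> nat) (m : nat) a :
    (forall y, 0 < w y)%N ->
    (forall y, \sum_(z | adj y z) w z <= m * w y)%N ->
  eigenvalue (adjacency_matrix R G) a -> a <= m%:R.
Proof.
move=> w0 wm /eigenfunction[x [y0 nz0] eqx].
have wR0 y : 0 < (w y)%:R :> R by rewrite ltr0n.
case: (@arg_maxP _ R _ y0 predT (fun y => `|x y| / (w y)%:R)) => // y _ maxy.
have xw z : `|x z| <= `|x y| / (w y)%:R * (w z)%:R.
  by rewrite -ler_pdivrMr //; apply: maxy.
have xy0 : 0 < `|x y|.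
  rewrite normr_gt0; apply: contra nz0 => /eqP xy0.
  by have := xw y0; rewrite xy0 normr0 !mul0r normr_le0.
rewrite -(ler_pM2r xy0); apply: le_trans (_ : `|a * x y| <= _).
  by rewrite normrM ler_pM2r // ler_norm.
rewrite -eqx; apply: le_trans (ler_norm_sum _ _ _) _.
apply: le_trans (ler_sum _ (fun z _ => xw z)) _.
rewrite -mulr_sumr -natr_sum mulrAC ler_pdivrMr // [leRHS]mulrAC -natrM mulrC.
by rewrite ler_pM2r // ler_nat.
Qed.

Lemma sqr_sum_le (A : {pred G}) x :
  (\sum_(z in A) x z) ^+ 2 <= #|A|%:R * \sum_(z in A) x z ^+ 2.
Proof.
rewrite expr2 mulr_suml.
under eq_bigr do rewrite mulr_sumr.
have le2 z t : x z * x t <= x z ^+ 2 / 2 + x t ^+ 2 / 2.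
  have := sqr_ge0 (x z - x t); nra.
apply: le_trans (ler_sum _ (fun z _ => ler_sum _ (fun t _ => le2 z t))) _.
under eq_bigr do rewrite big_split /= sumr_const.
rewrite big_split /= sumr_const sumrMnl -mulr_suml -mulrnDl -splitr.
by rewrite -[leLHS]mulr_natl.
Qed.

(** Outside the neighbourhood, [y] contributes [degree y] and each of the n - 1 - [degree y] other
    vertices at least 1. *)
Lemma sum_degree_nbhd (y : G) : (forall v : G, 0 < degree v)%N ->
  (\sum_(z | adj y z) degree z + #|G|.-1 <= \sum_(z : G) degree z)%N.
Proof.
move=> d0; rewrite [X in (_ <= X)%N](bigID (adj y)) /= leq_add2l.
have cG : (#|[set z | adj y z]| + #|~: [set z | adj y z]| = #|G|)%N by rewrite cardsC.
rewrite (bigD1 y) ?adj_irrefl //= {1}/degree.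
have : (#|~: [set z | adj y z] :\ y| <= \sum_(z | ~~ adj y z && (z != y)) degree z)%N.
  rewrite -sum1_card (eq_bigl (fun z => ~~ adj y z && (z != y))).
    by apply: leq_sum.
  by move=> z; rewrite !inE andbC.
move: cG; rewrite (cardsD1 y (~: _)) !inE adj_irrefl /= => <-; lia.
Qed.

(* Hong's bound: sum the Cauchy-Schwarz inequality over the rows of A x = a x. *)
Lemma eigenvalue_sqr_le a : (forall v : G, 0 < degree v)%N ->
    eigenvalue (adjacency_matrix R G) a ->
  a ^+ 2 + (#|G|.-1)%:R <= (\sum_(v : G) degree v)%:R.
Proof.
move=> d0 /eigenfunction[x [y0 nz0] eqx].
pose Q := \sum_y x y ^+ 2.
have Q0 : 0 < Q.
  rewrite /Q (bigD1 y0) //=; apply: ltr_pwDl.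
    by rewrite lt_def sqrf_eq0 nz0 sqr_ge0.
  by apply: sumr_ge0 => z _; apply: sqr_ge0.
rewrite -(ler_pM2r Q0) mulrDl -lerBrDr -mulrBl.
have -> : a ^+ 2 * Q = \sum_y (\sum_(z | adj y z) x z) ^+ 2.
  by rewrite mulr_sumr; apply: eq_bigr => y _; rewrite eqx exprMn.
have le_y y : (\sum_(z | adj y z) x z) ^+ 2 <= \sum_(z | adj y z) (degree y)%:R * x z ^+ 2.
  by have := sqr_sum_le (mem [set z | adj y z]) x; rewrite !big_set -mulr_sumr.
apply: le_trans (ler_sum _ (fun y _ => le_y y)) _.
(* After the exchange, the square of [x z] carries the degree sum over the neighbours of [z], which
   [sum_degree_nbhd] bounds. *)
rewrite (exchange_big_dep predT) //= mulr_sumr; apply: ler_sum => z _.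
rewrite -mulr_suml -natr_sum (eq_bigl (adj z)) => [|y]; last exact: adj_sym.
apply: ler_wpM2r; first exact: sqr_ge0.
by rewrite lerBrDr -natrD ler_nat sum_degree_nbhd.
Qed.
End Spectrum.

(** * Handshake parity and elementary facts on graphs *)

Lemma odd_sum_degree (G : sgraph) : ~~ odd (\sum_(v : G) degree v).
Proof.
(* [r] orients every edge, so the halved sum counts each edge once. *)
pose r (x y : G) := (enum_rank x < enum_rank y)%N.
have -> : (\sum_(v : G) degree v = (\sum_(v : G) \sum_(u : G) (adj v u && r v u)).*2)%N.
  rewrite -addnn [X in (_ = _ + X)%N]exchange_big -big_split /=.
  apply: eq_bigr => v _; rewrite -big_split /= /degree -sum1_card big_mkcond.
  apply: eq_bigr => u _; rewrite inE [adj u v]adj_sym /r.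
  have [_|_|/val_inj/enum_rank_inj ->] := ltngtP (enum_rank v) (enum_rank u);
  by rewrite ?andbT ?andbF ?adj_irrefl ?addn0 //; case: (adj _ _).
by rewrite odd_double.
Qed.

(** Lets each exceptional graph [H] be identified by naming the images of its vertices in [G]. *)
Lemma isomorphic_of_embedding (G H : sgraph) (f : H -> G) :
    injective f -> (#|G| <= #|H|)%N ->
    (forall x y, adj (f x) (f y) = adj x y) -> isomorphic G H.
Proof.
move=> injf leGH adjf; have [g fK gK] := inj_card_bij injf leGH.
exists g; first by exists f.
by move=> x y; rewrite -adjf !gK.
Qed.

Lemma traceable_hamilton_path (G : sgraph) :
  (0 < #|G|)%N -> traceable (@adj G) -> has_hamilton_path G.
Proof.
move=> /card_gt0P[v0 _] [[|x p] [pth us alls]]; last by exists x, p.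
by have := alls v0.
Qed.

Lemma degree_lt_card (G : sgraph) (v : G) : (degree v < #|G|)%N.
Proof.
apply: (@leq_ltn_trans #|[set~ v]|); last by rewrite cardsC1 prednK //; apply/card_gt0P; exists v.
apply/subset_leq_card/subsetP => y; rewrite !inE; by apply: contraTneq => ->; rewrite adj_irrefl.
Qed.

Lemma min_degree_le (G : sgraph) (v : G) : (min_degree G <= degree v)%N.
Proof.
rewrite /min_degree; have := mem_index_enum v.
elim: (index_enum G) => //= x s IH; rewrite inE big_cons geq_min.
by case/orP=> [/eqP->|/IH ->]; rewrite ?leqnn ?orbT.
Qed.

(** * The weight bound for j >= 2 and n >= 7 *)

(** [S] is a total weight, and [p], [q] are its deficits from n (n - 3); the claim is p + q >= 2 (n
    - 3). With j = k + 2 and n = 2k + 6 + t it follows from k^2 + k + 2kt + 2t >= 2, which fails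
    only at k = t = 0, that is (n, j) = (6, 2). *)
Lemma weight_sum_le (j n p q S : nat) : (j.*2.+2 <= n -> 1 < j -> 6 < n ->
    (j - 1) * (n - j) <= p -> (n - j.*2.+2) * j.+1 <= q ->
    S + p + q = n * (n - 3) ->
  S <= (n - 3) * (n - 3) + (n - 3))%N.
Proof.
move=> jn j1 n6.
have [k Ej] : exists k, j = k.+2 by exists (j - 2)%N; lia.
have [t En] : exists t, n = (k.*2 + 6 + t)%N by exists (n - j.*2.+2)%N; lia.
have -> : (n - j.*2.+2 = t)%N by lia.
have -> : (n - 3 = k.*2 + 3 + t)%N by lia.
have -> : (j - 1 = k.+1)%N by lia.
have -> : (n - j = k + 4 + t)%N by lia.
have kt : (0 < k + t)%N by lia.
rewrite En Ej -!mul2n; clear - kt.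
have : (t <= t * t)%N by nia.
have : (k <= k * k)%N by nia.
case: t kt => [|t] kt; nia.
Qed.

Lemma eigenvalue_le_low_degrees (R : realFieldType) (G : sgraph) (j : nat) (a : R) :
    low_degrees (@adj G) j -> (1 < j)%N -> (6 < #|G|)%N ->
  eigenvalue (adjacency_matrix R G) a -> a <= (#|G| - 3)%:R.
Proof.
move=> [jn cj cnj] j1 n6; set n := #|G| in jn cj cnj n6 *.
pose w (x : G) := (if degree x <= j then j
                   else if degree x <= n - j - 2 then n - j - 2 else n - 3)%N.
have w0 y : (0 < w y)%N by rewrite /w; case: ifP => _; [|case: ifP => _]; lia.
have w3 y : (w y <= n - 3)%N by rewrite /w; case: ifP => _; [|case: ifP => _]; lia.
(* The weight drops from n - 3 by j - 1 on entering the middle class, and by a further n - 2j - 2 on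
   entering the lowest. *)
have wE y : (w y + (j - 1) * (degree y <= n - j - 2)%N +
             (n - j.*2.+2) * (degree y <= j)%N = n - 3)%N.
  rewrite /w; case: (leqP (degree y) j) => h1;
    case: (leqP (degree y) (n - j - 2)) => h2; rewrite ?muln0 ?muln1; lia.
have cE i : (\sum_(y : G) (degree y <= i)%N = #|[set x : G | degree x <= i]|)%N.
  by rewrite -sum1_card [RHS]big_mkcond; apply: eq_bigr => y _; rewrite inE; case: leqP.
have sumw : (\sum_y w y <= (n - 3) * (n - 3) + (n - 3))%N.
  have : (\sum_(y : G) (n - 3) = n * (n - 3))%N by rewrite sum_nat_const.
  under eq_bigr => y _ do rewrite -(wE y).
  rewrite !big_split /= -!big_distrr /= !cE.
  have := leq_mul (leqnn (j - 1)) cnj; have := leq_mul (leqnn (n - j.*2.+2)) cj.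
  by move=> hq hp; apply: weight_sum_le jn j1 n6 hp hq.
apply: (@eigenvalue_le_weight _ _ w) => // y.
(* This suffices in the two low classes, where the degree is at most the weight. *)
have nbr : (\sum_(z | adj y z) w z <= degree y * (n - 3))%N.
  rewrite /degree -sum_nat_const; under [leqRHS]eq_bigl do rewrite inE.
  by apply: leq_sum.
have [dj|dj] := leqP (degree y) j.
  have -> : w y = j by rewrite /w dj.
  by apply: leq_trans nbr _; rewrite mulnC leq_mul2l dj orbT.
have [dnj|dnj] := leqP (degree y) (n - j - 2).
  have -> : w y = (n - j - 2)%N by rewrite /w leqNgt dj dnj.
  by apply: leq_trans nbr _; rewrite mulnC leq_mul2l dnj orbT.
have wy : w y = (n - 3)%N by rewrite /w !ifN // -ltnNge.
(* A vertex of weight n - 3 is not its own neighbour, so the total weight bounds its neighbour sum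
   with n - 3 to spare. *)
have : (\sum_(z | adj y z) w z + w y <= \sum_z w z)%N.
  rewrite [X in (_ <= X)%N](bigID (adj y)) leq_add2l /=.
  by rewrite (bigD1 y) ?adj_irrefl //= leq_addr.
rewrite wy => le1; rewrite -(leq_add2r (n - 3)); exact: leq_trans le1 sumw.
Qed.

(** * The case j = 1 *)

Lemma cards3 (T : finType) (a b c : T) :
  a != b -> c != a -> c != b -> #|[set a; b; c]| = 3.
Proof. by move=> ab ca cb; rewrite setUC cardsU1 cards2 !inE negb_or ca cb ab. Qed.

(** Two vertices have degree at most 1 and at most one vertex exceeds n - 3, so the degree sum is at
    most 1 + 1 + (n - 1) + (n - 3)^2. The hypothesis makes this an equality, which fixes all
    adjacencies. *)
Lemma isomorphic_join_clique (G : sgraph) :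
    low_degrees (@adj G) 1 ->
    ((#|G| - 3) ^ 2 + #|G| + 1 <= \sum_(v : G) degree v)%N ->
  isomorphic G (join (complete 1)
        (disjoint_union (complete (#|G| - 3)) (copies 2 (complete 1)))).
Proof.
move=> [n4 /card_gt1P[a [b []]]]; rewrite !inE -!/(degree _).
set n := #|G| in n4 *; move=> da db ab cB leD.
have {}cB : (n - 1 <= #|[set x : G | degree x <= n - 1 - 2]|)%N := cB.
have [h [ha hb dle]] : exists h, [/\ h != a, h != b & forall z, z != h -> (degree z <= n - 3)%N].
  pose B := [set x : G | (n - 3 < degree x)%N].
  have : (#|B| <= 1)%N.
    have -> : B = ~: [set x : G | degree x <= n - 1 - 2]%N.
      by apply/setP => x; rewrite !inE -ltnNge -subnDA.
    by have := cardsC [set x : G | degree x <= n - 1 - 2]%N; rewrite -/n; lia.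
  case: (set_0Vmem B) => [B0 _|[h hB] /card_le1_eqP B1].
    (* If no degree exceeds n - 3, any third vertex can serve as [h]. *)
    have /card_gt0P[h] : (0 < #|~: [set a; b]|)%N.
      by have := cardsC [set a; b]; rewrite cards2 ab -/n; lia.
    rewrite !inE negb_or => /andP[ha hb]; exists h; split=> // z _.
    by move/setP/(_ z): B0; rewrite !inE; lia.
  exists h; move: (hB); rewrite inE => dh; split.
  - by apply: contraTneq dh => ->; lia.
  - by apply: contraTneq dh => ->; lia.
  - by move=> z; apply: contraNT; rewrite -ltnNge => dz; apply/eqP/B1; rewrite // inE.
pose C := ~: [set a; b; h].
have cC : #|C| = (n - 3)%N.
  by have := cardsC [set a; b; h]; rewrite cards3 // -/C -/n; lia.
have sumE : (\sum_(v : G) degree v = degree a + degree b + degree h + \sum_(z in C) degree z)%N.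
  rewrite (bigD1 a) //= (bigD1 b) 1?eq_sym //= (bigD1 h) ?ha ?hb //= !addnA; congr (_ + _)%N.
  by apply: eq_bigl => z; rewrite !inE !negb_or.
have sC : (\sum_(z in C) degree z <= (n - 3) * (n - 3))%N.
  rewrite -{1}cC -sum_nat_const; apply: leq_sum => z; rewrite !inE !negb_or -andbA.
  by case/and3P=> _ _ zh; apply: dle.
have dh := degree_lt_card h.
have [dhE sCE] : degree h = n.-1 /\ (\sum_(z in C) degree z = (n - 3) * (n - 3))%N.
  by move: leD; rewrite sumE -mulnn; split; lia.
have adjh z : adj h z = (z != h).
  have /eqP/setP/(_ z) : [set z | adj h z] == [set~ h].
    rewrite eqEcard cardsC1 -dhE leqnn andbT; apply/subsetP => y; rewrite !inE.
    by apply: contraTneq => ->; rewrite adj_irrefl.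
  by rewrite !inE.
have leaf x z : x != h -> (degree x <= 1)%N -> adj x z = (z == h).
  move=> xh dx; have /eqP/setP/(_ z) : [set h] == [set z | adj x z].
    by rewrite eqEcard cards1 dx andbT sub1set inE adj_sym adjh.
  by rewrite !inE.
have adja z : adj a z = (z == h) by apply: leaf; rewrite // eq_sym.
have adjb z : adj b z = (z == h) by apply: leaf; rewrite // eq_sym.
have dC c : c \in C -> degree c = (n - 3)%N.
  move=> cc; apply/eqP; rewrite eqn_leq dle /=; last first.
    by move: cc; rewrite !inE !negb_or => /andP[].
  rewrite leqNgt; apply/negP => lt.
  have : (\sum_(z in C) degree z < (n - 3) * (n - 3))%N; last by rewrite sCE ltnn.
  rewrite -{1}cC -sum_nat_const (bigD1 c) //= [X in (_ < X)%N](bigD1 c) //= -addSn.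
  apply: leq_add => //; apply: leq_sum => z /andP[]; rewrite !inE !negb_or -andbA.
  by case/and3P=> _ _ zh _; apply: dle.
(* Only n - 3 vertices remain besides [a], [b] and [c], and the degree of [c] is n - 3. *)
have adjC c z : c \in C -> adj c z = [&& z != a, z != b & z != c].
  move=> cc; move: (cc); rewrite !inE !negb_or => /andP[/andP[ca cb] ch].
  have /eqP/setP/(_ z) : [set z | adj c z] == ~: [set a; b; c].
    rewrite eqEcard; apply/andP; split.
      apply/subsetP => y; rewrite !inE adj_sym => yc; rewrite !negb_or.
      by apply/andP; split; [apply/andP; split|]; apply: contraTneq yc => ->;
        rewrite ?adja ?adjb ?adj_irrefl.
    by have := cardsC [set a; b; c]; rewrite cards3 // -/n -/(degree c) dC //; lia.
  by rewrite !inE !negb_or -andbA.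
(* Since [C] has n - 3 elements, the default [h] is never returned. *)
have inC (i : 'I_(n - 3)) : nth h (enum C) i \in C.
  by rewrite -mem_enum mem_nth // -cardE cC.
pose f (x : 'I_1 + ('I_(n - 3) + 'I_2 * 'I_1)) : G :=
  match x with
  | inl _ => h
  | inr (inl i) => nth h (enum C) i
  | inr (inr p) => if p.1 == ord0 then a else b
  end.
have Cn c : c \in C -> [/\ c != a, c != b & c != h].
  by rewrite !inE !negb_or -andbA => /and3P[].
have n01 (i : 'I_2) : i != ord0 -> i = lift ord0 ord0.
  by case: i => [[|[|//]] ?] // _; apply: val_inj.
have nthE (i k : 'I_(n - 3)) : (nth h (enum C) i == nth h (enum C) k) = (i == k).
  by rewrite nth_uniq ?enum_uniq // -cardE cC.
have neq (x y : G) : x != y -> ((x == y) = false) * ((y == x) = false).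
  by move=> xy; rewrite [y == x]eq_sym (negPf xy).
have Cneq i := let: And3 ca cb ch := Cn _ (inC i) in (neq _ _ ca, neq _ _ cb, neq _ _ ch).
have neqs := (neq _ _ ab, neq _ _ ha, neq _ _ hb).
apply: (@isomorphic_of_embedding _ (join (complete 1)
  (disjoint_union (complete (n - 3)) (copies 2 (complete 1)))) f).
- move=> [i|[i|[i i0]]] [k|[k|[k k0]]] /=;
    rewrite ?(ord1 i) ?(ord1 k) ?(ord1 i0) ?(ord1 k0) => /eqP;
    do ?[case: (altP (_ =P ord0)) => [->|/n01 ->]]; rewrite ?nthE ?Cneq ?neqs //.
    by move/eqP->.
- have cM : #|{: 'I_1 + ('I_(n - 3) + 'I_2 * 'I_1)}| = (1 + (n - 3 + 2 * 1))%N.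
    by rewrite !card_sum card_prod !card_ord.
  by rewrite [X in (_ <= X)%N]cM -/n; lia.
- move=> [i|[i|[i i0]]] [k|[k|[k k0]]]; rewrite /= /complete_adj /= /copies_adj /= /complete_adj;
  rewrite ?(ord1 i) ?(ord1 k) ?(ord1 i0) ?(ord1 k0) ?eqxx ?andbF;
    do ?[case: (altP (_ =P ord0)) => _];
    rewrite ?adjh ?adja ?adjb ?adjC // ?nthE ?Cneq ?neqs ?eqxx //.
  by rewrite eq_sym.
Qed.

(* [lia] alone would split on each of the boolean counts. *)
Ltac count_lia :=
  repeat match goal with
  | H : context [nat_of_bool _] |- _ => move: H
  end;
  cbn [nat_of_bool];
  repeat match goal with
  | |- context [nat_of_bool ?b] => move: (nat_of_bool b) (leq_b1 b) => ? ?
  end;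
  lia.

(** * The case n = 6, j = 2 *)

Section SixVertices.
Variable G : sgraph.
Implicit Types (u v : G) (s : seq G).

Lemma degree_seq s (x : G) : uniq s -> (forall y, y \in s) -> degree x = count (adj x) s.
Proof. exact: card_count. Qed.

Lemma sum_seq (F : G -> nat) s : uniq s -> (forall y, y \in s) ->
  (\sum_v F v = \sum_(v <- s) F v)%N.
Proof.
by move=> us alls; rewrite [RHS]big_uniq //; apply: eq_bigl => v; rewrite alls.
Qed.

(** The low vertices form a list so that [labelling_perm] can move a chosen one to a chosen place;
    [u] and [v] are called hubs below. *)
Definition labelling u v s :=
  [/\ uniq [:: u, v & s], (forall x, x \in [:: u, v & s]), size s = 4 &
      forall x, x \in s -> (degree x <= 2)%N].

Lemma labelling_perm u v s t : perm_eq s t -> labelling u v s -> labelling u v t.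
Proof.
move=> st [us alls ss ds]; have uvst : perm_eq [:: u, v & s] [:: u, v & t].
  by rewrite !perm_cons.
split; first by rewrite -(perm_uniq uvst).
- by move=> x; rewrite -(perm_mem uvst).
- by rewrite -(perm_size st).
- by move=> x; rewrite -(perm_mem st); apply: ds.
Qed.

Lemma labelling_swap u v s : labelling u v s -> labelling v u s.
Proof.
move=> [us alls ss ds]; have p : perm_eq [:: u, v & s] [:: v, u & s].
  by apply/permP => f /=; rewrite addnCA.
by split=> // [|x]; rewrite -?(perm_uniq p) -?(perm_mem p).
Qed.

Lemma exists_labelling : #|G| = 6 -> (3 < #|[set x : G | degree x <= 2]|)%N ->
  exists u v s, labelling u v s.
Proof.
move=> n6 /card_geqP[s [us ss sub]].
have cs : #|[set x in s]| = 4 by rewrite cardsE (card_uniqP us).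
have /eqP/cards2P[u [v [uv Euv]]] : #|~: [set x in s]| = 2.
  by have := cardsC [set x in s]; rewrite cs n6; lia.
have mem_uv x : (x \in s) = ~~ ((x == u) || (x == v)).
  by move/setP/(_ x): Euv; rewrite !inE => <-; rewrite negbK.
exists u, v, s; split=> //.
- by rewrite /= inE !mem_uv !eqxx orbT us (negPf uv).
- by move=> x; rewrite !inE mem_uv orbA orbN.
- by move=> x /sub; rewrite inE.
Qed.

Section Labelled.
Variables (u v a b c d : G).
Hypothesis lab : labelling u v [:: a; b; c; d].
Hypothesis leD : (16 <= \sum_(x : G) degree x)%N.
Hypothesis uv : adj u v.

(** Degree sum 16 means at least 8 edges; 7 of them differ from the edge [u v]. *)
Lemma labelled_counts :
  [/\ adj u a + adj v a + (adj a b + adj a c + adj a d) <= 2,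
      adj u b + adj v b + (adj a b + adj b c + adj b d) <= 2,
      adj u c + adj v c + (adj a c + adj b c + adj c d) <= 2,
      adj u d + adj v d + (adj a d + adj b d + adj c d) <= 2 &
      7 <= (adj u a + adj u b + adj u c + adj u d) +
           (adj v a + adj v b + adj v c + adj v d) +
           (adj a b + adj a c + adj a d + adj b c + adj b d + adj c d)]%N.
Proof.
case: lab => us alls _ ds.
have := (ds a, ds b, ds c, ds d); rewrite !inE !eqxx !orbT.
case=> [[[/(_ isT) da /(_ isT) db] /(_ isT) dc] /(_ isT) dd].
move: leD da db dc dd; rewrite (sum_seq _ us alls) !big_cons big_nil.
rewrite !(degree_seq _ us alls) /= !adj_irrefl !(adj_sym _ u) !(adj_sym _ v).
rewrite (adj_sym b a) !(adj_sym c a) !(adj_sym c b) !(adj_sym d) [adj v u]adj_sym uv.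
by move=> *; split; count_lia.
Qed.

(** With E edges to the hubs and I edges among the low vertices, E + I >= 7 and E + 2I <= 8. So
    [a b] is the only low edge, [c] and [d] see both hubs, and [a] sees one; the path starts [b],
    [a], that hub. *)
Lemma traceable_low_edge : adj a b -> traceable (@adj G).
Proof.
move=> ab; have := labelled_counts; rewrite ab => -[ha hb hc hd hsum].
have [uc vc ud vd] : [/\ adj u c, adj v c, adj u d & adj v d].
  by split; rewrite -[adj _ _]lt0b; count_lia.
have : (0 < adj u a + adj v a)%N by count_lia.
rewrite addn_gt0 !lt0b => uva.
case: lab => us alls _ _; case/orP: uva => [ua|va].
  apply: (@traceable_perm _ _ _ [:: b; a; u; c; v; d] _ us) => //.
    by apply/permP => f /=; clear; count_lia.
  by rewrite /= vd uc [adj b a]adj_sym ab [adj a u]adj_sym ua [adj c v]adj_sym vc.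
apply: (@traceable_perm _ _ _ [:: b; a; v; c; u; d] _ us) => //.
  by apply/permP => f /=; clear; count_lia.
by rewrite /= ud vc [adj b a]adj_sym ab [adj a v]adj_sym va [adj c u]adj_sym uc.
Qed.

Hypothesis low_indep : {in [:: a; b; c; d] &, forall x y, ~~ adj x y}.

Let low_adj x y : x \in [:: a; b; c; d] -> y \in [:: a; b; c; d] -> adj x y = false.
Proof. by move=> hx hy; apply/negbTE/low_indep. Qed.

Lemma hub_counts :
  (7 <= (adj u a + adj u b + adj u c + adj u d) +
        (adj v a + adj v b + adj v c + adj v d))%N.
Proof.
case: labelled_counts => _ _ _ _.
suff -> : (adj a b + adj a c + adj a d + adj b c + adj b d + adj c d = 0)%N.
  by rewrite addn0.
by rewrite !low_adj ?inE ?eqxx ?orbT.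
Qed.

Lemma isomorphic_join_empty :
    {in [:: a; b; c; d], forall x, adj u x && adj v x} ->
  isomorphic G (join (complete 2) (copies 4 (complete 1))).
Proof.
move=> hub; have uvs x : x \in [:: a; b; c; d] -> (adj u x = true) * (adj v x = true).
  by move=> /hub/andP[-> ->].
case: lab => us alls _ _.
pose f (x : 'I_2 + 'I_4 * 'I_1) : G :=
  match x with inl i => if i == ord0 then u else v | inr p => nth u [:: a; b; c; d] p.1 end.
have inL (i : 'I_4) : nth u [:: a; b; c; d] i \in [:: a; b; c; d] by apply: mem_nth.
have n01 (i : 'I_2) : i != ord0 -> i = lift ord0 ord0.
  by case: i => [[|[|//]] ?] // _; apply: val_inj.
have nthE (i k : 'I_4) :
    (nth u [:: a; b; c; d] i == nth u [:: a; b; c; d] k) = (i == k).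
  by rewrite nth_uniq //; move: us => /=; do 2 case/andP=> _.
have neq (x : G) : x \in [:: a; b; c; d] ->
    ((x == u) = false) * ((u == x) = false) * ((x == v) = false) * ((v == x) = false).
  move=> xL; rewrite [u == x]eq_sym [v == x]eq_sym.
  move: us => /=; rewrite inE negb_or -andbA => /and4P[_ nu nv _].
  by split; [split; [split|]|]; apply: contraTF xL => /eqP->.
have uvE : ((u == v) = false) * ((v == u) = false).
  by rewrite [v == u]eq_sym; move: us => /=; rewrite inE negb_or => /andP[/andP[/negPf->]].
apply: (@isomorphic_of_embedding _ (join (complete 2) (copies 4 (complete 1))) f).
- move=> [i|[i i0]] [k|[k k0]] /=; rewrite ?(ord1 i0) ?(ord1 k0) => /eqP;
  do ?[case: (altP (_ =P ord0)) => [->|/n01 ->]]; rewrite ?nthE ?(neq _ (inL _)) ?uvE //.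
  by move/eqP->.
- have cM : #|{: 'I_2 + 'I_4 * 'I_1}| = 6 by rewrite card_sum card_prod !card_ord.
  rewrite [X in (_ <= X)%N]cM; have <- : size [:: u; v; a; b; c; d] = 6 by [].
  rewrite -(card_uniqP us); apply/subset_leq_card/subsetP => x _; exact: alls.
- have hubs (i : 'I_2) (k : 'I_4) :
      adj (if i == ord0 then u else v) (nth u [:: a; b; c; d] k) = true.
    by case: ifP => _; rewrite (uvs _ (inL k)).
  move=> [i|[i i0]] [k|[k k0]]; rewrite /= /complete_adj /= /copies_adj /= /complete_adj;
  rewrite ?(ord1 i0) ?(ord1 k0) ?eqxx ?andbF ?(low_adj (inL _) (inL _)) ?hubs //;
    last by rewrite adj_sym hubs.
  do 2 case: (altP (_ =P ord0)) => [->|/n01 ->]; by rewrite ?adj_irrefl ?uv // adj_sym uv.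
Qed.
(** Here [u] is the dominating vertex, [v] the centre of the claw with leaves [a], [b], [c], and [d]
    the remaining single vertex. *)
Lemma isomorphic_join_claw :
    {in [:: a; b; c; d], forall x, adj u x} ->
    {in [:: a; b; c; d], forall x, adj v x = (x != d)} ->
  isomorphic G (join (complete 1)
    (disjoint_union (complete_bipartite 1 3) (complete 1))).
Proof.
move=> us' vs'; case: lab => us alls _ _.
pose f (x : 'I_1 + (('I_1 + 'I_3) + 'I_1)) : G :=
  match x with
  | inl _ => u
  | inr (inl (inl _)) => v
  | inr (inl (inr i)) => nth u [:: a; b; c] i
  | inr (inr _) => d
  end.
have inL (i : 'I_3) : nth u [:: a; b; c] i \in [:: a; b; c; d].
  by rewrite (mem_subseq (subseq_rcons [:: a; b; c] d)) // mem_nth.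
have dL : d \in [:: a; b; c; d] by rewrite !inE eqxx !orbT.
have usd : uniq [:: d; a; b; c].
  by rewrite -(rot_uniq 1); move: us => /and3P[_ _].
have nthE (i k : 'I_3) : (nth u [:: a; b; c] i == nth u [:: a; b; c] k) = (i == k).
  by rewrite nth_uniq //; move: usd => /andP[].
have nd (i : 'I_3) : ((nth u [:: a; b; c] i == d) = false) * ((d == nth u [:: a; b; c] i) = false).
  rewrite [d == _]eq_sym; move: usd => /andP[nd _].
  by have /negPf-> : nth u [:: a; b; c] i != d by apply: contraNneq nd => <-; apply: mem_nth.
have neq (x : G) : x \in [:: a; b; c; d] ->
    ((x == u) = false) * ((u == x) = false) * ((x == v) = false) * ((v == x) = false).
  move=> xL; rewrite [u == x]eq_sym [v == x]eq_sym.
  move: us => /=; rewrite inE negb_or -andbA => /and4P[_ nu nv _].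
  by split; [split; [split|]|]; apply: contraTF xL => /eqP->.
have uvE : ((u == v) = false) * ((v == u) = false).
  by rewrite [v == u]eq_sym; move: us => /=; rewrite inE negb_or => /andP[/andP[/negPf->]].
apply: (@isomorphic_of_embedding _ (join (complete 1)
    (disjoint_union (complete_bipartite 1 3) (complete 1))) f).
- move=> [i|[[i|i]|i]] [k|[[k|k]|k]] /= => /eqP;
  rewrite ?nthE ?nd ?(neq _ (inL _)) ?(neq _ dL) ?uvE //;
  by rewrite ?(ord1 i) ?(ord1 k) // => /eqP->.
- have cM : #|{: 'I_1 + (('I_1 + 'I_3) + 'I_1)}| = 6 by rewrite !card_sum !card_ord.
  rewrite [X in (_ <= X)%N]cM; have <- : size [:: u; v; a; b; c; d] = 6 by [].
  rewrite -(card_uniqP us); apply/subset_leq_card/subsetP => x _; exact: alls.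
- move=> [i|[[i|i]|i]] [k|[[k|k]|k]]; rewrite /= /complete_adj ?(ord1 i) ?(ord1 k) ?eqxx;
  rewrite ?adj_irrefl ?uv ?[adj v u]adj_sym ?uv ?(low_adj (inL _) (inL _))
     ?(low_adj dL (inL _)) ?(low_adj (inL _) dL)
     ?(us' _ (inL _)) ?(us' _ dL) ?(vs' _ (inL _)) ?(vs' _ dL) ?nd ?eqxx //=;
  rewrite [adj (_) _]adj_sym ?(us' _ (inL _)) ?(us' _ dL) ?(vs' _ (inL _)) ?(vs' _ dL) ?nd ?eqxx //.
Qed.
End Labelled.

(** Give the hubs weight 3 and the others 2. A low vertex has neighbour sum at most 2 * 3 = 3 * 2;
    for non-adjacent hubs the sum is at most 4 * 2 < 3 * 3. Then every eigenvalue is at most 3. *)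
Lemma hubs_adjacent (R : realFieldType) (rho : R) u v s :
    labelling u v s -> eigenvalue (adjacency_matrix R G) rho -> 3%:R < rho ->
  adj u v.
Proof.
move=> [us alls ss ds] eig; apply: contraTT => nuv; rewrite -leNgt.
pose w x := (2 + (x \in [:: u; v]))%N.
apply: (@eigenvalue_le_weight _ _ w) => // y.
have degE x : degree x = (\sum_(z | adj x z) 1)%N.
  by rewrite sum1_card; apply: eq_card => z; rewrite inE.
have [ys|ys] := boolP (y \in s).
  apply: (@leq_trans (3 * degree y)); last first.
    by rewrite leq_mul2l /w (leq_trans (ds _ ys)) // leq_addr.
  rewrite degE big_distrr /=; apply: leq_sum => z _.
  by rewrite /w muln1; case: (_ \in _).
have yuv : y \in [:: u; v].
  by have := alls y; rewrite -[_ :: _]/([:: u; v] ++ s) mem_cat (negPf ys) orbF.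
have far z : z \in [:: u; v] -> adj y z = false.
  by move: yuv; rewrite !inE => /orP[]/eqP-> /orP[]/eqP->; rewrite ?adj_irrefl //;
    apply/negbTE; rewrite // adj_sym.
have -> : (\sum_(z | adj y z) w z = \sum_(z | adj y z) 2)%N.
  apply: eq_bigr => z yz; rewrite /w; case: (boolP (z \in _)) => // /far.
  by rewrite yz.
have dy : (degree y <= 4)%N.
  rewrite (degree_seq _ us alls) /= !far ?inE ?eqxx ?orbT // !add0n.
  by apply: leq_trans (count_size _ _) _; rewrite ss.
have -> : (\sum_(z | adj y z) 2 = 2 * degree y)%N.
  by rewrite degE big_distrr /=; apply: eq_bigr => z _; rewrite muln1.
by rewrite /w yuv; lia.
Qed.

(** An edge between low vertices gives a path. Otherwise at least seven of the eight edges from hubs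
    to low vertices are present, and the two exceptional graphs correspond to none or one
    missing. *)
Lemma six_vertices (R : realFieldType) (rho : R) :
    #|G| = 6 -> (3 < #|[set x : G | degree x <= 2]|)%N ->
    (16 <= \sum_(x : G) degree x)%N ->
    eigenvalue (adjacency_matrix R G) rho -> 3%:R < rho ->
  [\/ traceable (@adj G), isomorphic G (join (complete 2) (copies 4 (complete 1)))
    | isomorphic G (join (complete 1)
        (disjoint_union (complete_bipartite 1 3) (complete 1)))].
Proof.
move=> n6 /(exists_labelling n6)[u [v [s lab]]] leD eig rho3.
have uv := hubs_adjacent lab eig rho3.
have split4 x : x \in s -> exists y z t, perm_eq s [:: x; y; z; t].
  move=> xs; have := perm_to_rem xs; case: lab => _ _ ss _.
  have : size (rem x s) = 3 by rewrite size_rem // ss.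
  case: (rem x s) => [|y [|z [|t [|//]]]] // _ p; by exists y, z, t.
case: (boolP [exists x, (x \in s) && [exists y, (y \in s) && adj x y]]).
  case/existsP=> x /andP[xs /existsP[y /andP[ys xy]]]; constructor 1.
  have yx : y \in rem x s.
    case: lab => /= /and3P[_ _ us] _ _ _; rewrite (mem_rem_uniq x us) inE ys andbT.
    by apply: contraTneq xy => ->; rewrite adj_irrefl.
  have p : perm_eq s [:: x, y & rem y (rem x s)].
    by apply: perm_trans (perm_to_rem xs) _; rewrite perm_cons perm_to_rem.
  have := labelling_perm p lab; case: (lab) => _ _ ss _.
  have : size (rem y (rem x s)) = 2 by rewrite !size_rem ?ss.
  case: (rem y _) => [|z [|t [|//]]] // _ lab'.
  exact: (traceable_low_edge lab' leD uv xy).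
rewrite negb_exists => /forallP indep.
have low_indep : {in s &, forall x y, ~~ adj x y}.
  move=> x y xs ys; move: (indep x); rewrite xs negb_exists => /forallP/(_ y).
  by rewrite ys.
case: (boolP (all (fun x => adj u x && adj v x) s)) => [/allP hub|/allPn[x xs nx]].
  constructor 2; have [x xs] : exists x, x \in s.
    by case: lab => _ _; case: (s) => // x q _ _; exists x; apply: mem_head.
  have [y [z [t p]]] := split4 x xs; have ps := perm_mem p.
  apply: (isomorphic_join_empty (labelling_perm p lab) uv).
    by move=> x1 x2; rewrite -!ps; apply: low_indep.
  by move=> x1; rewrite -ps; apply: hub.
constructor 3; have [y [z [t p]]] := split4 x xs.
have p' : perm_eq s [:: y; z; t; x].
  by apply: perm_trans p _; rewrite -[[:: y; z; t; x]]/(rcons [:: y; z; t] x) perm_sym perm_rcons.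
have ps := perm_mem p'; have lab' := labelling_perm p' lab.
have indep' : {in [:: y; z; t; x] &, forall x y, ~~ adj x y}.
  by move=> x1 x2; rewrite -!ps; apply: low_indep.
(* Exchanging the hubs if necessary, the missing edge is at [v]; the count then forces the other
   seven. *)
wlog vx : u v lab lab' uv nx / ~~ adj v x.
  move=> H; case: (boolP (adj v x)) => vx; last exact: (H u v).
  apply: (H v u); rewrite // ?[adj v u]adj_sym //.
  - exact: labelling_swap.
  - exact: labelling_swap.
  - by rewrite andbC.
  - by move: nx; rewrite vx andbT.
have := hub_counts lab' leD uv indep'; rewrite (negPf vx) => hsum.
have [[uy uz ut ux] [vy vz vt]] : [/\ adj u y, adj u z, adj u t & adj u x] /\
    [/\ adj v y, adj v z & adj v t] by split; split; rewrite -[adj _ _]lt0b; count_lia.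
apply: (isomorphic_join_claw lab' uv indep') => x1; rewrite !inE => /or4P[]/eqP-> //.
all: rewrite ?vy ?vz ?vt ?eqxx ?(negPf vx) //; apply/esym.
all: by apply: contraNneq vx => <-.
Qed.
End SixVertices.

(** * The edge bound and the final case analysis *)

(** Hong's bound gives a degree sum of at least (n - 3)^2 + n; with k = n - 3 this is k (k + 1) + 3,
    an odd number, so parity gains one more. *)
Lemma sum_degree_ge (R : realFieldType) (G : sgraph) (a : R) :
    (3 < #|G|)%N -> (forall v : G, 0 < degree v)%N ->
    eigenvalue (adjacency_matrix R G) a -> (#|G| - 3)%:R < a ->
  ((#|G| - 3) ^ 2 + #|G| + 1 <= \sum_(v : G) degree v)%N.
Proof.
move=> n4 d0 eig lta; have hong := eigenvalue_sqr_le d0 eig.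
have lt2 : ((#|G| - 3) ^ 2)%:R < a ^+ 2.
  by rewrite natrX ltr_sqr ?nnegrE ?ler0n // ltW // (le_lt_trans _ lta).
have : ((#|G| - 3) ^ 2 + #|G|.-1 < \sum_(v : G) degree v)%N.
  by rewrite -(ltr_nat R) natrD (lt_le_trans _ hong) // ltrD2r.
have := odd_sum_degree G; move: (\sum_v _)%N #|G| n4 => S n n4 oddS.
have [k ->] : exists k, n = (k + 3)%N by exists (n - 3)%N; lia.
rewrite addnK addn3 /= => ltS.
suff : S != (k ^ 2 + k + 3)%N by lia.
apply: contraNneq oddS => ->.
by rewrite -mulnn addn3 /= !negbK oddD oddM andbb addbb.
Qed.

Theorem theorem1 (R : rcfType) (G : sgraph) (n : nat) (rho : R) :
  #|G| = n -> (4 <= n)%N -> (1 <= min_degree G)%N ->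
  is_spectral_radius G rho -> n%:R - 3 < rho ->
  [\/ has_hamilton_path G,
      isomorphic G (join (complete 1)
        (disjoint_union (complete (n - 3)) (copies 2 (complete 1)))),
      isomorphic G (join (complete 2) (copies 4 (complete 1)))
    | isomorphic G (join (complete 1)
        (disjoint_union (complete_bipartite 1 3) (complete 1)))].
Proof.
move=> <- {n} n4 dmin [eig _].
rewrite -natrB ?(ltnW n4) // => rho_gt.
have d0 (v : G) : (0 < degree v)%N := leq_trans dmin (min_degree_le v).
have leD := sum_degree_ge n4 d0 eig rho_gt.
have hamilton := @traceable_hamilton_path G (ltnW (ltnW (ltnW n4))).
case: (traceable_or_low_degrees (@adj_sym G) (@adj_irrefl G)) => [/hamilton ?|[j low]].
  by constructor 1.
have [jn cj cnj] := low.
(* For j = 0 some vertex would have degree 0. *)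
have j0 : (0 < j)%N.
  have /card_gt0P[v] : (0 < #|[set x : G | degree x <= j]|)%N by apply: leq_trans cj.
  by rewrite inE; apply: leq_trans.
case: (ltnP 1 j) => [j1|j1]; last first.
  have j1E : j = 1 by apply/eqP; rewrite eqn_leq j1.
  by rewrite j1E in low; constructor 2; apply: isomorphic_join_clique leD.
case: (ltnP 6 #|G|) => [n7|n6].
  by have := eigenvalue_le_low_degrees low j1 n7 eig; rewrite leNgt rho_gt.
have [n6E j2] : #|G| = 6 /\ j = 2 by move: jn n6 j1; rewrite -mul2n; split; lia.
rewrite n6E in leD rho_gt cnj.
(* At (6, 2) this condition reads: at least four vertices have degree at most 2. *)
rewrite j2 in cnj.
case: (six_vertices n6E cnj leD eig rho_gt) => [/hamilton ?|?|?].
- by constructor 1.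
- by constructor 3.
- by constructor 4.
Qed.
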